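(* Let $\beta=(B,(B_i)_{i\in I_\beta})$ be a regular hypertope with $I_\beta=\{1,\ldots,n\}$ and distinguished generators $b_1,\ldots,b_n$, so $B=\langle b_i\mid i\in I_\beta\rangle$. Fix $j\in I_\beta$ such that $X_j=\{\sigma B_j\mid\sigma\in B\}$ is finite with more than one element, and let $\mathcal{D}=\mathcal{D}(\beta,j,\lambda)$ be a $j$-diagonal Coxeter graph. Let $\mathcal{G}$ be a finite Coxeter graph with vertex set $I_{\mathcal{G}}=\{-r,\ldots,-1\}$ and a selected vertex $k\in I_{\mathcal{G}}$, to be identified with the vertex $B_j$ of $\mathcal{D}$. Let $A=W(\operatorname{Ext}(\mathcal{G},\mathcal{D}))$, let $\alpha$ be its standard coset incidence system, and set $F_L=B_j$ for the orbit $L=V(\mathcal{D})$. Then the Coxeter diagram of the hypertope $\mathcal{T}(\alpha,\beta)$ is obtained from the disjoint union of $\mathcal{G}$ and the Coxeter diagram of $\beta$ (with vertex set $I_\beta$), all edges and labels kept, by adding a single edge joining $k\in I_{\mathcal{G}}$ and $j\in I_\beta$, labelled $2m$, where $m=\lambda([B_j,b_jB_j])$ (and $2m=\infty$ if $m=\infty$).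
   Context: Coset incidence systems. Given a group $B$ and a family $(B_i)_{i\in I_\beta}$ of subgroups (the maximal parabolic subgroups), the coset incidence system $\beta=(B,(B_i)_{i\in I_\beta})$ has as elements of type $i$ the left cosets $bB_i$; two cosets are incident if they intersect. $B$ acts by left multiplication. For $J\subseteq I_\beta$, $B_J=\bigcap_{i\in J}B_i$ and $B_\emptyset=B$. A flag is a set of pairwise incident elements (distinct incident elements have different types), a chamber is a flag with an element of every type, and the system is an incidence geometry if every maximal flag is a chamber. Regular hypertopes. A regular hypertope is an incidence geometry that is thin (every rank-one residue has exactly two elements), residually connected (every residue of rank at least two has connected incidence graph), and has a flag-transitive automorphism group. When a coset incidence system $(B,(B_i)_{i\in I_\beta})$ is called a regular hypertope, $B$ itself is its (type-preserving) automorphism group, i.e. $B$ acts faithfully and flag-transitively. Its distinguished generators are the involutions $b_i$ with $B_{I_\beta\setminus\{i\}}=\langle b_i\rangle$; they generate $B$. Its Coxeter diagram is the labelled graph on these generators (indexed by the types) in which the label between $i\neq l$ is the order of $b_ib_l$, edges with label $2$ being omitted. Coxeter graphs. A Coxeter graph $\mathcal{G}$ is a simple graph with edges labelled by elements of $\{3,4,\ldots\}\cup\{\infty\}$; $m_{s,t}$ is the label of $\{s,t\}$, and $m_{s,t}=2$ for distinct non-adjacent $s,t$. $W(\mathcal{G})$ is generated by $a_s$ ($s\in V(\mathcal{G})$) with defining relations $a_s^2=1$ and $(a_sa_t)^{m_{s,t}}=1$ when $m_{s,t}<\infty$. Its standard coset incidence system is $(W(\mathcal{G}),(W(\mathcal{G})_s)_{s\in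 V(\mathcal{G})})$ with $W(\mathcal{G})_s=\langle a_t\mid t\ne s\rangle$. Diagonal Coxeter graph. A $j$-diagonal is an unordered pair $\{F_1,F_2\}$ of distinct elements of $X_j$. Two $j$-diagonals are equivalent if some $b\in B$ maps one to the other (as unordered pairs); the class is $[F_1,F_2]$ and $\mathcal{C}^j_\beta$ is the set of classes. Given a label function $\lambda:\mathcal{C}^j_\beta\to\{2,3,\ldots\}\cup\{\infty\}$, $\mathcal{D}(\beta,j,\lambda)$ has vertex set $X_j$, with distinct $F_1,F_2$ joined iff $\lambda([F_1,F_2])\ne2$, the edge then being labelled $\lambda([F_1,F_2])$. Extension. Let $\mathcal{G},\mathcal{D}$ be Coxeter graphs with distinguished vertices $v_{\mathcal{G}},v_{\mathcal{D}}$ and otherwise disjoint vertex sets. $\mathcal{K}=\operatorname{Ext}(\mathcal{G},\mathcal{D})$ has vertex set obtained from $V(\mathcal{G})\sqcup V(\mathcal{D})$ by identifying $v_{\mathcal{G}}$ and $v_{\mathcal{D}}$ to one vertex $v$; all edges of $\mathcal{G}$ and $\mathcal{D}$ remain with their labels; if $w\in V(\mathcal{G})\setminus\{v\}$ is joined to $v$ in $\mathcal{G}$ with label $q$, then $w$ is joined to every $w'\in V(\mathcal{D})\setminus\{v\}$ with label $q$; there are no other edges. Here $v_{\mathcal{G}}=k$, $v_{\mathcal{D}}=B_j$. Action. $B$ acts on $V(\mathcal{K})$ by fixing each vertex of $V(\mathcal{G})\setminus\{v\}$ and by left multiplication on $V(\mathcal{D})=X_j$; $\eta:B\to\operatorname{Aut}(A)$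 is given by $\eta(b)(a_s)=a_{b\cdot s}$. Twisting. Let $\alpha=(A,(A_i)_{i\in V(\mathcal{K})})$, let $\Omega$ be the set of $B$-orbits on $V(\mathcal{K})$ (namely $V(\mathcal{D})$ and the singletons of $V(\mathcal{G})\setminus\{v\}$), with chosen representatives $F_L\in L$. Then $\mathcal{T}(\alpha,\beta)=(G,(G_i)_{i\in I_\beta\sqcup\Omega})$ with $G=A\rtimes_\eta B$, $G_i=A_{\bigcup_{L\in\Omega}(L\setminus (B_i\cdot F_L))}\rtimes B_i$ for $i\in I_\beta$, and $G_L=A_L\rtimes B$ for $L\in\Omega$, where $A_J=\bigcap_{i\in J}A_i$ for $J\subseteq V(\mathcal{K})$, $A_\emptyset=A$. It is a regular hypertope. In its diagram, the orbit type $V(\mathcal{D})$ is named $k$ and the orbit type $\{i\}$, $i\in I_{\mathcal{G}}\setminus\{k\}$, is named $i$. *)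

(* Defs.v *)
From HB Require Import structures.
From mathcomp Require Import all_boot.
From mathcomp Require Import boolp classical_sets functions cardinality.
From mathcomp Require Import generic_quotient.
From Stdlib Require Import Relation_Operators.

Set Implicit Arguments.
Unset Strict Implicit.
Unset Printing Implicit Defensive.

Local Open Scope quotient_scope.
Local Open Scope classical_set_scope.
Local Open Scope group_scope.

(* Groups are arbitrary (possibly infinite) [groupType]s; subgroups and cosets
   are classical sets of elements.                                            *)

Section Groups.
Variable G : groupType.
Implicit Types (x y : G) (H : set G).

Definition is_subgroup H : Prop :=
  [/\ H 1, (forall x y, H x -> H y -> H (x * y)) & forall x, H x -> H x^-1].

Definition generated (X : set G) : set G := smallest is_subgroup X.

Definition ltrans x H : set G := [set x * y | y in H].

Definition cosets H : set (set G) := [set ltrans x H | x in [set: G]].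

(* Orders, like the labels of Coxeter graphs, live in [option nat];
   [None] stands for infinity.                                                *)
Definition order x : option nat :=
  if pselect (exists k, (0 < k)%N && `[< x ^+ k = 1 >]) is left ex
  then Some (ex_minn ex) else None.

End Groups.

Definition label := option nat.

Definition label_ge2 (q : label) : bool := if q is Some q' then 1 < q' else true.

Definition label_double (q : label) : label := omap (fun q' => (2 * q')%N) q.

Section CosetSystems.
Variable I : Type.

(* That the maximal parabolics are subgroups is part of [regular_hypertope].  *)
Record cosys := CoSys {
  cs_group :> groupType;
  cs_par : I -> set cs_group }.
Arguments cs_par : clear implicits.

Variable S : cosys.

Definition parabolic (J : set I) : set S := \bigcap_(i in J) cs_par S i.

(* The type is stored with the coset, since a set may be a coset of several
   maximal parabolics.                                                        *)
Definition element : set (I * set S) := [set x | cosets (cs_par S x.1) x.2].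

Definition incident (x y : I * set S) : Prop := x.2 `&` y.2 !=set0.

Definition translate (b : S) (x : I * set S) : I * set S := (x.1, ltrans b x.2).

Definition flag (Phi : set (I * set S)) : Prop :=
  Phi `<=` element /\ forall x y, Phi x -> Phi y -> incident x y.

Definition types_of (Phi : set (I * set S)) : set I := [set x.1 | x in Phi].

Definition chamber Phi : Prop := flag Phi /\ types_of Phi = [set: I].

Definition maximal_flag Phi : Prop :=
  flag Phi /\ forall Psi, flag Psi -> Phi `<=` Psi -> Psi = Phi.

Definition incidence_geometry : Prop :=
  forall Phi, maximal_flag Phi -> chamber Phi.

Definition residue (Phi : set (I * set S)) : set (I * set S) :=
  [set x | [/\ element x, ~ Phi x & forall y, Phi y -> incident x y]].

Definition thin : Prop :=
  forall Phi i, flag Phi -> types_of Phi = [set~ i] ->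
    exists x y, x <> y /\ residue Phi = [set x; y].

Definition residue_path (Phi : set (I * set S)) :
    I * set S -> I * set S -> Prop :=
  clos_refl_trans _
    (fun x y => [/\ residue Phi x, residue Phi y & incident x y]).

(* Rank at least two: two distinct types are missing from the flag.           *)
Definition residually_connected : Prop :=
  forall Phi i l, flag Phi -> i <> l -> ~ types_of Phi i -> ~ types_of Phi l ->
    forall x y, residue Phi x -> residue Phi y -> residue_path Phi x y.

Definition flag_transitive : Prop :=
  forall Phi Psi, flag Phi -> flag Psi -> types_of Phi = types_of Psi ->
    exists b, translate b @` Phi = Psi.

Definition faithful_action : Prop :=
  forall b, (forall x, element x -> translate b x = x) -> b = 1.

Definition regular_hypertope : Prop :=
  [/\ (forall i, is_subgroup (cs_par S i)),
      incidence_geometry, thin, residually_connected &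
      flag_transitive /\ faithful_action].

Definition distinguished_generators (b : I -> S) : Prop :=
  forall i, [/\ b i <> 1, b i * b i = 1 &
                parabolic [set~ i] = generated [set b i]].

Definition diagram (b : I -> S) (i l : I) : label := order (b i * b l).

End CosetSystems.
Arguments cs_par [I] _ _.

(* A Coxeter graph on V is given by its labels [m s t] for [s <> t], the value
   [Some 2] meaning that s and t are not joined.  Diagonal values are junk.   *)
Definition coxeter_graph (V : Type) (m : V -> V -> label) : Prop :=
  (forall s t, m s t = m t s) /\ (forall s t, s <> t -> label_ge2 (m s t)).

Definition graph_isomorphism (V V' : Type) (m : V -> V -> label)
    (m' : V' -> V' -> label) (f : V -> V') : Prop :=
  bijective f /\ forall s t, s <> t -> m' (f s) (f t) = m s t.

Section Presentations.
Variables (S : Type) (R : set (seq (S * bool))).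

(* (s, true) is the letter s, (s, false) its formal inverse.                  *)
Definition word := {classic seq (S * bool)}.

Inductive pres_eq : seq (S * bool) -> seq (S * bool) -> Prop :=
| pres_refl u : pres_eq u u
| pres_sym u v : pres_eq u v -> pres_eq v u
| pres_trans u v w : pres_eq u v -> pres_eq v w -> pres_eq u w
| pres_cat u u' v v' : pres_eq u u' -> pres_eq v v' -> pres_eq (u ++ v) (u' ++ v')
| pres_inv s e : pres_eq [:: (s, e); (s, ~~ e)] [::]
| pres_rel w : R w -> pres_eq w [::].

Definition pres_eqb : rel word := fun u v => `[< pres_eq u v >].

Lemma pres_eqb_equiv : equiv_class_of pres_eqb.
Proof.
split=> [u | u v | v u w].
- exact/asboolP/pres_refl.
- by apply/asboolP/asboolP; exact: pres_sym.
- by move=> /asboolP uv /asboolP vw; apply/asboolP; exact: pres_trans vw.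
Qed.

Canonical pres_equivRel := EquivRelPack pres_eqb_equiv.

Definition pres := {eq_quot pres_equivRel}.
HB.instance Definition _ := Choice.on pres.
HB.instance Definition _ := EqQuotient.on pres.

Definition pres_of (w : seq (S * bool)) : pres := \pi_pres (w : word).

Lemma pres_ofP u v : pres_of u = pres_of v <-> pres_eq u v.
Proof.
split=> [/eqP | uv]; last by apply/eqP; rewrite eqmodE; apply/asboolP.
by rewrite eqmodE => /asboolP.
Qed.

Definition pres_word (x : pres) : seq (S * bool) := repr x.

Lemma pres_wordK x : pres_of (pres_word x) = x.
Proof. exact: reprK. Qed.

Lemma pres_ofK u : pres_eq (pres_word (pres_of u)) u.
Proof. by apply/pres_ofP; rewrite pres_wordK. Qed.

Definition inv_word (w : seq (S * bool)) : seq (S * bool) :=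
  rev [seq (x.1, ~~ x.2) | x <- w].

Lemma inv_word_cons s e w :
  inv_word ((s, e) :: w) = inv_word w ++ [:: (s, ~~ e)].
Proof. by rewrite /inv_word /= rev_cons cats1. Qed.

Lemma inv_wordK : involutive inv_word.
Proof.
move=> w; rewrite /inv_word map_rev revK -map_comp -[RHS]map_id.
by apply: eq_map => -[s e] /=; rewrite negbK.
Qed.

Lemma pres_invr w : pres_eq (w ++ inv_word w) [::].
Proof.
elim: w => [|[s e] w IHw]; first exact: pres_refl.
rewrite inv_word_cons cat_cons catA -cat_cons -[(s, e) :: _]cat1s.
apply: pres_trans (pres_inv s e).
rewrite -[X in pres_eq _ X]/([:: (s, e)] ++ [:: (s, ~~ e)]).
apply: pres_cat (pres_refl _).
by rewrite -[X in pres_eq _ X]cats0; apply: pres_cat (pres_refl _) IHw.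
Qed.

Lemma pres_invl w : pres_eq (inv_word w ++ w) [::].
Proof. by have := pres_invr (inv_word w); rewrite inv_wordK. Qed.

Definition pres_mul (x y : pres) : pres := pres_of (pres_word x ++ pres_word y).
Definition pres_one : pres := pres_of [::].
Definition pres_invg (x : pres) : pres := pres_of (inv_word (pres_word x)).

Lemma pres_mulE u v : pres_mul (pres_of u) (pres_of v) = pres_of (u ++ v).
Proof. by apply/pres_ofP/pres_cat; exact: pres_ofK. Qed.

Lemma pres_mulA : associative pres_mul.
Proof.
move=> x y z; rewrite -[x]pres_wordK -[y]pres_wordK -[z]pres_wordK.
by rewrite !pres_mulE catA.
Qed.

Lemma pres_mul1 : left_id pres_one pres_mul.
Proof. by move=> x; rewrite -[x]pres_wordK pres_mulE. Qed.

Lemma pres_mulr1 : right_id pres_one pres_mul.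
Proof. by move=> x; rewrite -[x]pres_wordK pres_mulE cats0. Qed.

Lemma pres_mulV : left_inverse pres_one pres_invg pres_mul.
Proof.
move=> x; rewrite -{2}[x]pres_wordK pres_mulE.
exact/pres_ofP/pres_invl.
Qed.

Lemma pres_mulrV : right_inverse pres_one pres_invg pres_mul.
Proof.
move=> x; rewrite -{1}[x]pres_wordK pres_mulE.
exact/pres_ofP/pres_invr.
Qed.

HB.instance Definition _ := isGroup.Build pres
  pres_mulA pres_mul1 pres_mulr1 pres_mulV pres_mulrV.

Definition pres_gen (s : S) : pres := pres_of [:: (s, true)].

End Presentations.

Section Actions.
Variable B : groupType.

Record action (V : Type) := Action {
  act :> B -> V -> V;
  act_1 : forall v, act 1 v = v;
  act_M : forall b c v, act (b * c) v = act b (act c v) }.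

Definition orbit V (a : action V) (v : V) : set V := range (a ^~ v).

Definition orbits V (a : action V) : set (set V) := range (orbit a).

Definition orbit_of V (a : action V) (v : V) : orbits a :=
  exist _ (orbit a v) (mem_set (imageT (orbit a) v)).

(* Homomorphisms from B to the automorphism group of A.                       *)
Record aut_action (A : groupType) := AutAction {
  aut_act :> action A;
  aut_mulg : forall b x y, aut_act b (x * y) = aut_act b x * aut_act b y }.

Record semidirect (A : groupType) (eta : aut_action A) :=
  SemiDirect { sd_left : A; sd_right : B }.

Section SemiDirect.
Variables (A : groupType) (eta : aut_action A).
Notation sd := (semidirect eta).

HB.instance Definition _ := gen_eqMixin sd.
HB.instance Definition _ := gen_choiceMixin sd.

Definition sd_mul (x y : sd) : sd :=
  SemiDirect eta (sd_left x * eta (sd_right x) (sd_left y))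
                 (sd_right x * sd_right y).
Definition sd_one : sd := SemiDirect eta 1 1.
Definition sd_inv (x : sd) : sd :=
  SemiDirect eta (eta (sd_right x)^-1 (sd_left x)^-1) (sd_right x)^-1.

Lemma aut_act1 b : eta b 1 = 1.
Proof. by apply: (mulgI (eta b 1)); rewrite -aut_mulg !mulg1. Qed.

Lemma sd_mulA : associative sd_mul.
Proof.
by move=> [x b] [y c] [z d]; rewrite /sd_mul /= aut_mulg act_M !mulgA.
Qed.

Lemma sd_mul1 : left_id sd_one sd_mul.
Proof. by move=> [x b]; rewrite /sd_mul /= act_1 !mul1g. Qed.

Lemma sd_mulr1 : right_id sd_one sd_mul.
Proof. by move=> [x b]; rewrite /sd_mul /= aut_act1 !mulg1. Qed.

Lemma sd_mulV : left_inverse sd_one sd_inv sd_mul.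
Proof.
by move=> [x b]; rewrite /sd_mul /sd_inv /= -aut_mulg !mulVg aut_act1.
Qed.

Lemma sd_mulrV : right_inverse sd_one sd_inv sd_mul.
Proof.
by move=> [x b]; rewrite /sd_mul /sd_inv /= -act_M !mulgV act_1 mulgV.
Qed.

HB.instance Definition _ := isGroup.Build sd
  sd_mulA sd_mul1 sd_mulr1 sd_mulV sd_mulrV.

Definition semidirect_set (X : set A) (Y : set B) : set sd :=
  [set x | X (sd_left x) /\ Y (sd_right x)].

End SemiDirect.

Lemma ltrans_cosets (b : B) (H : set B) (F : cosets H) :
  ltrans b (val F) \in cosets H.
Proof.
case: F => F /= /set_mem[x _ <-]; apply/mem_set; exists (b * x) => //.
apply/seteqP; split=> [_ [y Hy <-] | _ [_ [y Hy <-] <-]].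
- by exists (x * y); [exists y | rewrite mulgA].
- by exists y; rewrite // mulgA.
Qed.

Definition coset_mul (H : set B) (b : B) (F : cosets H) : cosets H :=
  exist _ (ltrans b (val F)) (ltrans_cosets b F).

Lemma ltrans1 (F : set B) : ltrans 1 F = F.
Proof.
apply/seteqP; split=> [_ [y Fy <-] | y Fy]; first by rewrite mul1g.
by exists y; rewrite ?mul1g.
Qed.

Lemma ltransM b c (F : set B) : ltrans (b * c) F = ltrans b (ltrans c F).
Proof.
apply/seteqP; split=> [_ [y Fy <-] | _ [_ [y Fy <-] <-]].
- by exists (c * y); [exists y | rewrite mulgA].
- by exists y; rewrite // mulgA.
Qed.

Lemma coset_mul1 H (F : cosets H) : coset_mul 1 F = F.
Proof. by apply: val_inj; exact: ltrans1. Qed.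

Lemma coset_mulM H b c (F : cosets H) :
  coset_mul (b * c) F = coset_mul b (coset_mul c F).
Proof. by apply: val_inj; exact: ltransM. Qed.

Definition coset_action (H : set B) : action (cosets H) :=
  Action (@coset_mul1 H) (@coset_mulM H).

Definition trivial_coset (H : set B) : cosets H :=
  exist _ (ltrans 1 H) (mem_set (ex_intro2 _ _ 1 I erefl)).

(* The class [F1, F2]: the B-translates of the unordered pair {F1, F2}.  A
   label function on the set of classes of j-diagonals is a function on all
   sets of sets of cosets, of which only the values on these classes matter.  *)
Definition diagonal_class (F1 F2 : set B) : set (set (set B)) :=
  range (fun b => [set ltrans b F1; ltrans b F2]).

Definition diagonal_classes (H : set B) : set (set (set (set B))) :=
  [set c | exists F1 F2 : cosets H,
             F1 <> F2 /\ c = diagonal_class (val F1) (val F2)].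

Definition diagonal_graph (H : set B) (lam : set (set (set B)) -> label)
    (F1 F2 : cosets H) : label :=
  lam (diagonal_class (val F1) (val F2)).

Lemma diagonal_class_ltrans b F1 F2 :
  diagonal_class (ltrans b F1) (ltrans b F2) = diagonal_class F1 F2.
Proof.
apply/seteqP; split=> [_ [c _ <-] | _ [c _ <-]].
- by exists (c * b); rewrite // !ltransM.
- by exists (c * b^-1); rewrite // -!ltransM mulgVK.
Qed.

End Actions.

Section Extension.
Variables (VG VD : Type) (vG : VG).

(* V(G) minus vG, plus V(D): the merged vertex v is represented by the
   distinguished vertex vD of D.  A vertex w of G other than vG has the same
   label with every vertex of D, namely the one it has with vG in G (label 2
   if w and vG are not joined); so the labels do not depend on vD.            *)
Definition ext_vertex : Type := ([set~ vG] + VD)%type.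

Definition ext_graph (mG : VG -> VG -> label) (mD : VD -> VD -> label)
    (x y : ext_vertex) : label :=
  match x, y with
  | inl w, inl w' => mG (val w) (val w')
  | inl w, inr _ => mG (val w) vG
  | inr _, inl w => mG (val w) vG
  | inr F, inr F' => mD F F'
  end.

(* The inclusion of V(G), sending vG to the merged vertex.                    *)
Definition ext_incl (vD : VD) (w : VG) : ext_vertex :=
  if insub w is Some u then inl u else inr vD.

Variables (B : groupType) (a : action B VD).

Definition ext_act (b : B) (x : ext_vertex) : ext_vertex :=
  match x with inl w => inl w | inr F => inr (a b F) end.

Lemma ext_act1 x : ext_act 1 x = x.
Proof. by case: x => //= F; rewrite act_1. Qed.

Lemma ext_actM b c x : ext_act (b * c) x = ext_act b (ext_act c x).
Proof. by case: x => //= F; rewrite act_M. Qed.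

Definition ext_action : action B ext_vertex := Action ext_act1 ext_actM.

End Extension.

Section CoxeterGroups.
Variables (V : Type) (m : V -> V -> label).

Definition coxeter_relators : set (seq (V * bool)) :=
  [set w | (exists s, w = [:: (s, true); (s, true)]) \/
           (exists s t q, [/\ s <> t, m s t = Some q &
              w = flatten (nseq q [:: (s, true); (t, true)])])].

Definition coxeter_group := pres coxeter_relators.
HB.instance Definition _ := Group.on coxeter_group.

Definition coxeter_gen (s : V) : coxeter_group := pres_gen coxeter_relators s.

Definition coxeter_system : cosys V :=
  @CoSys V coxeter_group (fun s => generated [set coxeter_gen t | t in [set~ s]]).

Variables (B : groupType) (a : action B V).
Hypothesis a_inv : forall b s t, m (a b s) (a b t) = m s t.

Definition act_word (b : B) (w : seq (V * bool)) : seq (V * bool) :=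
  [seq (a b x.1, x.2) | x <- w].

Lemma act_word_eq b u v :
  pres_eq coxeter_relators u v ->
  pres_eq coxeter_relators (act_word b u) (act_word b v).
Proof.
elim=> {u v} [u|u v _|u v w _ uv _|u u' v v' _ uu' _ vv'|s e|w].
- exact: pres_refl.
- exact: pres_sym.
- exact: pres_trans uv.
- by rewrite /act_word !map_cat; apply: pres_cat.
- exact: (@pres_inv _ coxeter_relators (a b s) e).
- case=> [[s ->]|[s [t [q [st mst ->]]]]]; apply: pres_rel.
    by left; exists (a b s).
  right; exists (a b s), (a b t), q; split; rewrite ?a_inv //.
    by move=> /(congr1 (a b^-1)); rewrite -!act_M mulVg !act_1.
  by rewrite /act_word map_flatten map_nseq.
Qed.

Definition coxeter_act (b : B) (x : coxeter_group) : coxeter_group :=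
  pres_of coxeter_relators (act_word b (pres_word x)).

Lemma coxeter_act_of b u :
  coxeter_act b (pres_of coxeter_relators u) =
  pres_of coxeter_relators (act_word b u).
Proof. exact/pres_ofP/act_word_eq/pres_ofK. Qed.

(* This determines the action, since the generators generate.                 *)
Lemma coxeter_act_gen b s : coxeter_act b (coxeter_gen s) = coxeter_gen (a b s).
Proof. exact: coxeter_act_of. Qed.

Lemma coxeter_act1 x : coxeter_act 1 x = x.
Proof.
rewrite -[RHS]pres_wordK /coxeter_act; congr pres_of.
by rewrite -[RHS]map_id; apply: eq_map => -[s e]; rewrite act_1.
Qed.

Lemma coxeter_actM b c x :
  coxeter_act (b * c) x = coxeter_act b (coxeter_act c x).
Proof.
rewrite [coxeter_act c x]/coxeter_act coxeter_act_of; congr pres_of.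
by rewrite /act_word -map_comp; apply: eq_map => -[s e] /=; rewrite act_M.
Qed.

Lemma coxeter_act_mulg b (x y : coxeter_group) :
  coxeter_act b (x * y) = coxeter_act b x * coxeter_act b y.
Proof.
rewrite [x * y]/(pres_mul x y) coxeter_act_of /act_word map_cat.
exact: esym (pres_mulE _ _ _).
Qed.

Definition coxeter_aut : aut_action B coxeter_group :=
  @AutAction _ coxeter_group (Action coxeter_act1 coxeter_actM) coxeter_act_mulg.

End CoxeterGroups.

Section Twisting.
Variables (I V : Type) (beta : cosys I) (alpha : cosys V).
Variables (a : action beta V) (eta : aut_action beta alpha).
Variable F : orbits a -> V.

Definition twist_par (x : I + orbits a) : set (semidirect eta) :=
  match x with
  | inl i => semidirect_set
      (parabolic (\bigcup_(L in [set: orbits a])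
                    (val L `\` [set a b (F L) | b in cs_par beta i])))
      (cs_par beta i)
  | inr L => semidirect_set (parabolic (val L)) [set: beta]
  end.

Definition twist : cosys (I + orbits a) :=
  @CoSys (I + orbits a) (semidirect eta) twist_par.

End Twisting.

Section DiagonalExtension.
Variables (IG I : Type) (mG : IG -> IG -> label) (k : IG).
Variables (beta : cosys I) (j : I).
Variable lam : set (set (set beta)) -> label.

Definition Xj : set (set beta) := cosets (cs_par beta j).

Definition K_vertex : Type := ext_vertex Xj k.

Definition K_graph : K_vertex -> K_vertex -> label :=
  ext_graph mG (diagonal_graph lam).

Definition K_action : action beta K_vertex :=
  ext_action k (coset_action (cs_par beta j)).

Lemma K_action_graph b x y :
  K_graph (K_action b x) (K_action b y) = K_graph x y.
Proof.
case: x => [w|F]; case: y => [w'|F'] //=.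
by rewrite /diagonal_graph /= diagonal_class_ltrans.
Qed.

Definition K_system : cosys K_vertex := coxeter_system K_graph.

Definition K_aut : aut_action beta K_system := coxeter_aut K_action_graph.

Definition K_base : K_vertex := inr (trivial_coset (cs_par beta j)).

Definition K_incl (w : IG) : K_vertex := ext_incl k (trivial_coset (cs_par beta j)) w.

(* The names of the types of the twisting: k names the orbit V(D) of the
   vertex B_j, and every other i names the singleton orbit {i}.               *)
Definition twist_type (x : I + IG) : I + orbits K_action :=
  match x with
  | inl i => inl i
  | inr w => inr (orbit_of K_action (K_incl w))
  end.

End DiagonalExtension.

(* Disjoint union of two graphs, plus one edge labelled q joining j and k; all
   other cross pairs are unjoined (label 2).                                   *)
Definition join_graph (I J : eqType) (m : I -> I -> label) (m' : J -> J -> label)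
    (j : I) (k : J) (q : label) (x y : I + J) : label :=
  match x, y with
  | inl i, inl l => m i l
  | inr s, inr t => m' s t
  | inl i, inr s | inr s, inl i => if (i == j) && (s == k) then q else Some 2
  end.

(* Main.v *)
From mathcomp Require Import all_boot ssralg poly ssrnum algC cyclotomic ring.
From mathcomp Require Import boolp classical_sets functions cardinality.
Require Import Defs.

(** The distinguished generators of the twisting are those of its two factors:
    (1, b_i) for a type i of beta, and (a_v, 1) for an orbit L, where v is the
    representative of L.  Once this is known, every label of the diagram is the
    order of an explicit product in the semidirect product.  Two generators
    from the same factor multiply inside that factor, so their labels are those
    of the diagram of beta and of the Coxeter graph of A, the latter restricted
    to the representatives, which form a copy of G.  In the mixed case
    (1, b_i)(a_v, 1) = (a_{b_i v}, b_i) is an involution when b_i fixes v.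
    Otherwise its odd powers are nontrivial, having second component b_i, and
    its square is (a_{b_i v} a_v, 1), so its order is twice the label of
    {v, b_i v}.  The vertices of G other than k are fixed by B, and b_i fixes
    the vertex B_j exactly when i <> j; hence a single new edge appears, between
    j and k, with label 2 m.

    Two facts about a Coxeter group W enter.

    - The order of a_s a_t is the label m s t ([order_coxeter_gen]).  The
      relations bound the order from above.  For the lower bound, W acts by
      reflections on the functions on its vertices with values in a field
      containing enough roots of unity, and a_s a_t has a root of unity of order
      m s t as an eigenvalue (4 when the label is infinite).

    - The intersection of the maximal parabolics W_s, for s in J, is generated
      by the a_t with t outside J ([coxeter_parabolic]).  The set of reflections
      occurring an odd number of times along a word depends only on the group
      element ([reflections_parity]); along a reduced word they are pairwise
      distinct.  Thus if x lies in W_s then so do all reflections along a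
      reduced word of x, as a word for x avoiding s shows; the letters of the
      reduced word are then in W_s too, and a_s is not in W_s because it moves a
      function fixed by all other generators.

    With J the set of all vertices, respectively all vertices but one, the
    second fact computes the first component of the intersections of maximal
    parabolics of the twisting; in the second component, thinness and flag
    transitivity of beta force b_i to lie outside B_i
    ([distinguished_notin]), so that the B_i have trivial intersection. *)

Set Implicit Arguments.
Unset Strict Implicit.
Unset Printing Implicit Defensive.

Local Open Scope classical_set_scope.
Local Open Scope group_scope.

(** * Subgroups, cosets, orders and orbits *)

Section GroupFacts.
Variable G : groupType.
Implicit Types (x y : G) (H X : set G).

Lemma generated_subgroup X : is_subgroup (generated X).
Proof.
split=> [H [[]]//|x y Hx Hy H HX|x Hx H HX].
- by case: (HX) => -[_ HM _] _; apply: HM; [exact: Hx|exact: Hy].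
- by case: (HX) => -[_ _ HV] _; apply: HV; exact: Hx.
Qed.

Lemma sub_generated X : X `<=` generated X.
Proof. exact: sub_gen_smallest. Qed.

Lemma generated_sub X H : is_subgroup H -> X `<=` H -> generated X `<=` H.
Proof. exact: smallest_sub. Qed.

Lemma generated_involution x : x * x = 1 -> generated [set x] = [set 1; x].
Proof.
move=> xx; have xV : x^-1 = x by apply: mulg1_eq.
apply/seteqP; split.
  apply: generated_sub => [|y ->]; last by right.
  split=> [|y z [->|->] [->|->]|y [->|->]]; rewrite ?mulg1 ?mul1g ?xx ?invg1 ?xV;
    by [left|right].
move=> y [->|->]; first by case: (generated_subgroup [set x]).
exact: sub_generated.
Qed.

(** With infinity read as 0, the order generates the ideal of exponents killing
    x; this treats finite and infinite orders uniformly. *)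
Lemma expg_order x k : x ^+ k = 1 <-> odflt 0 (order x) %| k.
Proof.
rewrite /order; case: pselect => [ex|nex] /=.
  case: ex_minnP => q /andP[q0 /asboolP xq] qmin.
  have xmod l : x ^+ l = x ^+ (l %% q).
    by rewrite {1}(divn_eq l q) expgnDr mulnC expgnA xq expg1n mul1g.
  split=> [xk|/dvdnP[l ->]]; last by rewrite mulnC expgnA xq expg1n.
  rewrite /dvdn; apply: contraPT xk; rewrite -lt0n xmod => k0 xk.
  have := qmin (k %% q); rewrite k0 leqNgt ltn_pmod //=.
  by move=> H; have := H (introT (asboolP _) xk).
rewrite dvd0n; split=> [xk|/eqP->//].
apply: contra_notT nex => k0; exists k; rewrite lt0n k0 /=; exact/asboolP.
Qed.

Lemma order_neq0 x : order x <> Some 0.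
Proof.
rewrite /order; case: pselect => [ex|nex] //=.
by case: ex_minnP => -[|q] // /andP[].
Qed.

Lemma orderE x (q : label) : q <> Some 0 ->
  (forall k, x ^+ k = 1 <-> odflt 0 q %| k) -> order x = q.
Proof.
move=> q0 qP; have eq k : (odflt 0 (order x) %| k) = (odflt 0 q %| k).
  by apply/idP/idP; [move/expg_order/qP | move/qP/expg_order].
have := @order_neq0 x; have : odflt 0 (order x) = odflt 0 q.
  by apply/eqP; rewrite eqn_dvd eq dvdnn -eq dvdnn.
by case: (order x) q q0 {qP eq} => [u|] [v|] //= v0 e u0;
  [rewrite e | case: u0; rewrite e | case: v0; rewrite -e].
Qed.

Lemma order_involution x : x <> 1 -> x * x = 1 -> order x = Some 2.
Proof.
move=> x1 xx; apply: orderE => // k /=; rewrite dvdn2.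
rewrite -{1}[k]odd_double_half -muln2 mulnC expgnDr expgnA expg2 xx expg1n mulg1.
by rewrite expgb; case: odd.
Qed.

Lemma order_double x : (forall k, x ^+ k = 1 -> ~~ odd k) ->
  order x = label_double (order (x * x)).
Proof.
move=> even; have := @order_neq0 (x * x); have := @expg_order (x * x).
set q := order _ => qP q0; have dq : odflt 0 (label_double q) = (2 * odflt 0 q)%N.
  by case: (q).
apply: orderE => [|k]; first by case: (q) q0 => [[|u]|] // [].
rewrite dq -[k]odd_double_half -muln2 (mulnC k./2).
split=> [xk|]; last first.
  case: (boolP (odd k)) => ok.
    by move/(dvdn_trans (dvdn_mulr _ (dvdnn 2))); rewrite dvdn2 oddD oddb mul2n odd_double.
  by rewrite add0n dvdn_pmul2l // expgnA expg2; move/qP.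
have := even _ xk; rewrite oddD oddb mul2n odd_double addbF => /negbTE ok.
by move: xk; rewrite -mul2n ok !add0n dvdn_pmul2l // expgnA expg2; move/qP.
Qed.

End GroupFacts.

Lemma eq_order_expg (G H : groupType) (x : G) (y : H) :
  (forall k, x ^+ k = 1 <-> y ^+ k = 1) -> order x = order y.
Proof.
move=> xy; apply: orderE => [|k]; first exact: order_neq0.
by rewrite xy; exact: expg_order.
Qed.

Lemma order_mulC (G : groupType) (x y : G) : order (x * y) = order (y * x).
Proof.
apply: eq_order_expg => k; have -> : x * y = (y * x) ^ x^-1.
  by rewrite conjgE invgK !mulgA mulgK.
by rewrite -conjXg; split=> /eqP; rewrite ?conjg_eq1 => /eqP // ->; rewrite conj1g.
Qed.

Section Cosets.
Variables (G : groupType) (H : set G).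
Hypothesis subH : is_subgroup H.

Lemma ltrans_refl x : ltrans x H x.
Proof. by case: subH => H1 _ _; exists 1; rewrite ?mulg1. Qed.

Lemma ltrans_id x : H x -> ltrans x H = H.
Proof.
case: subH => H1 HM HV Hx; apply/seteqP; split=> [_ [y Hy <-]|y Hy].
  exact: HM.
by exists (x^-1 * y); rewrite ?mulVKg //; apply: HM => //; exact: HV.
Qed.

Lemma ltrans_eq x : ltrans x H = H -> H x.
Proof. by move=> <-; exact: ltrans_refl. Qed.

Lemma coset_meet F : cosets H F -> F `&` H !=set0 -> F = H.
Proof.
case: subH => H1 HM HV [x _ <-] [_ [[y Hy <-] Hxy]]; apply: ltrans_id.
by rewrite -[x](mulgK y); apply: HM => //; exact: HV.
Qed.

End Cosets.

Section Orbits.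
Variables (B : groupType) (V : Type) (a : action B V).

Lemma orbit_refl v : orbit a v v.
Proof. by exists 1 => //; exact: act_1. Qed.

Lemma orbits_eq (L : orbits a) v : val L v -> L = orbit_of a v.
Proof.
case: L => L LP /= Lv; apply: val_inj => /=.
have [u _ uL] := set_mem LP; rewrite -uL in Lv *.
case: Lv => b _ <-; apply/seteqP; split=> [_ [c _ <-]|_ [c _ <-]].
  by exists (c * b^-1); rewrite // -act_M mulgVK.
by exists (c * b); rewrite // act_M.
Qed.

End Orbits.

(** * Words and reflections in a Coxeter group *)

Section CoxeterWords.
Variables (V : Type) (m : V -> V -> label).
Notation W := (coxeter_group m).
Notation gen := (coxeter_gen m).
Implicit Types (s t : V) (w z : seq V) (x y : W).

Lemma coxeter_gen_sq s : gen s * gen s = 1.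
Proof.
transitivity (pres_of (coxeter_relators m) [:: (s, true); (s, true)]).
  exact: pres_mulE.
by apply/pres_ofP/pres_rel; left; exists s.
Qed.

Lemma coxeter_genV s : (gen s)^-1 = gen s.
Proof. exact/mulg1_eq/coxeter_gen_sq. Qed.

Lemma coxeter_genK s x : gen s * (gen s * x) = x.
Proof. by rewrite mulgA coxeter_gen_sq mul1g. Qed.

Lemma coxeter_relation s t q : s <> t -> m s t = Some q ->
  (gen s * gen t) ^+ q = 1.
Proof.
move=> st mst.
transitivity (pres_of (coxeter_relators m) (flatten (nseq q [:: (s, true); (t, true)]))).
  elim: q {mst} => [|q IHq] //=; rewrite expgS IHq.
  transitivity (pres_of (coxeter_relators m) [:: (s, true); (t, true)] *
     pres_of (coxeter_relators m) (flatten (nseq q [:: (s, true); (t, true)]))).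
    congr (_ * _); exact: pres_mulE.
  exact: pres_mulE.
by apply/pres_ofP/pres_rel; right; exists s, t, q.
Qed.

Definition word_val w : W := foldr (fun s x => gen s * x) 1 w.

Lemma word_val_cat w z : word_val (w ++ z) = word_val w * word_val z.
Proof. by elim: w => [|s w IHw] /=; rewrite ?mul1g // IHw mulgA. Qed.

Lemma pres_of_word_val (u : seq (V * bool)) :
  pres_of (coxeter_relators m) u = word_val (map fst u).
Proof.
elim: u => [|[s e] u IHu] //=; rewrite -IHu.
transitivity (pres_of (coxeter_relators m) [:: (s, e)] *
              pres_of (coxeter_relators m) u); first exact/esym/pres_mulE.
congr (_ * _); case: e => //; rewrite -[RHS]coxeter_genV; apply/esym/mulg1_eq.
transitivity (pres_of (coxeter_relators m) [:: (s, true); (s, false)]).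
  exact: pres_mulE.
by apply/pres_ofP; exact: (@pres_inv _ _ s true).
Qed.

Lemma word_val_pres_word x : word_val (map fst (pres_word x)) = x.
Proof. by rewrite -pres_of_word_val pres_wordK. Qed.

Section Lift.
Variables (X : Type) (phi : V -> X -> X).
Hypothesis phiK : forall s, involutive (phi s).
Hypothesis phi_rel : forall s t q, s <> t -> m s t = Some q ->
  forall p, iter q (phi s \o phi t) p = p.

(** An action of the generators by involutions satisfying the relations depends
    on words only through their values; it serves both for the action on signed
    reflections and for the geometric representation. *)
Lemma coxeter_lift w z : word_val w = word_val z ->
  forall p, foldr phi p w = foldr phi p z.
Proof.
have lift u v : pres_eq (coxeter_relators m) u v ->
    forall p, foldr phi p (map fst u) = foldr phi p (map fst v).
  elim=> {u v} [//|u v _ E p|u v y _ E1 _ E2 p|u u' v v' _ E1 _ E2 p|s e p|].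
  - by rewrite E.
  - by rewrite E1.
  - by rewrite !map_cat !foldr_cat E2 E1.
  - exact: phiK.
  move=> y [[s ->] p|[s [t [q [st mst ->]]]] p]; first exact: phiK.
  rewrite -[RHS](phi_rel st mst); elim: q {mst} => //= q IHq.
  by rewrite IHq.
pose tag := map (fun s : V => (s, true)).
have tagK w' : map fst (tag w') = w' by rewrite -map_comp map_id.
by rewrite -(tagK w) -(tagK z) -!pres_of_word_val => /pres_ofP/lift.
Qed.

End Lift.

(** The reflections t such that right multiplication by t amounts to deleting one
    letter of the word, listed with multiplicity. *)
Fixpoint reflections w : seq W :=
  if w is s :: w' then
    ((word_val w')^-1 * gen s * word_val w') :: reflections w'
  else [::].

(** The classical action on signed reflections, extended to all of W so that no
    set of reflections has to be singled out. *)
Definition reflection_act s (p : W * bool) : W * bool :=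
  (gen s * p.1 * gen s, p.2 (+) (p.1 == gen s)).

Lemma reflection_actK s : involutive (reflection_act s).
Proof.
move=> [x e]; rewrite /reflection_act /=; congr pair.
  by rewrite !mulgA coxeter_gen_sq mul1g -mulgA coxeter_gen_sq mulg1.
have -> : (gen s * x * gen s == gen s) = (x == gen s).
  rewrite -(inj_eq (mulIg (gen s))) -mulgA coxeter_gen_sq mulg1.
  by rewrite -(inj_eq (mulgI (gen s))) coxeter_genK mulg1.
by rewrite -addbA addbb addbF.
Qed.

(** The reflections of the dihedral group generated by s and t, met along the
    alternating word of length 2k, are the elements t(st)^i for i < 2k. *)
Lemma reflection_act_iter s t k x e :
  iter k (reflection_act s \o reflection_act t) (x, e) =
  ((gen s * gen t) ^+ k * x * (gen s * gen t) ^- k,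
   e (+) odd (count_mem x (mkseq (fun i => gen t * (gen s * gen t) ^+ i) k.*2))).
Proof.
set c := gen s * gen t; have cE : gen s * gen t = c by [].
have cV : c^-1 = gen t * gen s by rewrite invgM !coxeter_genV.
have tc y : gen t * (c * y) = c^-1 * (gen t * y).
  by rewrite cV -cE !mulgA.
clearbody c.
have tck k' y : gen t * (c ^+ k' * y) = c ^- k' * (gen t * y).
  elim: k' y => [|k' IHk] y; first by rewrite invg1 !mul1g.
  by rewrite {1}expgS -mulgA tc IHk expgSr invgM !mulgA.
elim: k => [|k IHk]; first by rewrite /= expg0 invg1 mulg1 mul1g addbF.
have mkseqSS (f : nat -> W) : mkseq f k.+1.*2 = mkseq f k.*2 ++ [:: f k.*2; f k.*2.+1].
  by rewrite /mkseq doubleS -[_.+2]addn2 iotaD map_cat.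
rewrite iterS IHk mkseqSS count_cat oddD /= addn0 oddD !oddb.
rewrite /reflection_act /=; congr pair.
  by rewrite expgS invgM cV -cE !mulgA.
rewrite -!addbA; congr (_ (+) (_ (+) _)).
have conj_eq (y z : W) : (c ^+ k * y * c ^- k == z) = (c ^- k * z * c ^+ k == y).
  rewrite -(inj_eq (mulIg (c ^+ k))) mulgVK -(inj_eq (mulgI (c ^- k))).
  by rewrite -mulgA mulKg eq_sym mulgA.
have ckt y : c ^- k * (gen t * y) = gen t * (c ^+ k * y) by rewrite tck.
congr (_ (+) _); first by rewrite conj_eq -mulgA ckt -expgnDr addnn.
rewrite -(inj_eq (mulIg (gen t))) -mulgA coxeter_gen_sq mulg1.
rewrite -(inj_eq (mulgI (gen t))) coxeter_genK conj_eq.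
by rewrite -!mulgA ckt (mulgA (gen s)) cE -expgS -expgnDr addnS addnn.
Qed.

(** The list of the t(st)^i for i < 2q runs twice through the same q elements when
    (st)^q = 1, so no sign changes. *)
Lemma reflection_act_rel s t q : s <> t -> m s t = Some q ->
  forall p, iter q (reflection_act s \o reflection_act t) p = p.
Proof.
move=> st mst [x e]; rewrite reflection_act_iter (coxeter_relation st mst).
rewrite mul1g invg1 mulg1; congr pair.
rewrite -addnn /mkseq iotaD map_cat count_cat oddD add0n.
have -> : iota q q = map (addn q) (iota 0 q) by rewrite -iotaDl addn0.
rewrite -map_comp.
rewrite [in X in _ (+) (_ (+) X)](eq_map (g := fun i => gen t * (gen s * gen t) ^+ i)).
  by rewrite addbb addbF.
by move=> i /=; rewrite expgnDr (coxeter_relation st mst) mul1g.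
Qed.

(** The action on signed reflections flips the sign of x once for each occurrence
    of x among the reflections of the word. *)
Lemma reflections_parity w z : word_val w = word_val z ->
  forall x, odd (count_mem x (reflections w)) = odd (count_mem x (reflections z)).
Proof.
have fold w' x : foldr reflection_act (x, false) w' =
    (word_val w' * x * (word_val w')^-1, odd (count_mem x (reflections w'))).
  elim: w' => [|s w' IHw] /=; first by rewrite mul1g invg1 mulg1.
  rewrite IHw /reflection_act /= oddD oddb addbC invgM coxeter_genV !mulgA.
  congr (_, _ (+) _).
  rewrite -(inj_eq (mulIg (word_val w'))) mulgVK.
  by rewrite -(inj_eq (mulgI (word_val w')^-1)) mulKg eq_sym mulgA.
move=> wz x; have := coxeter_lift reflection_actK reflection_act_rel wz (x, false).
by rewrite !fold => -[].
Qed.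

Lemma reflections_delete w x : x \in reflections w ->
  exists2 z, word_val z = word_val w * x & (size z).+1 = size w.
Proof.
elim: w => [|s w IHw] //=; rewrite inE => /orP[/eqP ->|/IHw[z zx sz]].
  by exists w; rewrite // !mulgA mulgK coxeter_gen_sq mul1g.
by exists (s :: z); rewrite /= ?sz // zx mulgA.
Qed.

Definition reduced w :=
  forall z, word_val z = word_val w -> (size w <= size z)%N.

Lemma reduced_word x : exists2 w, word_val w = x & reduced w.
Proof.
have ex : exists k, `[< exists2 w, word_val w = x & size w = k >].
  exists (size (pres_word x)); apply/asboolP.
  by exists (map fst (pres_word x)); rewrite ?size_map ?word_val_pres_word.
case: (ex_minnP ex) => k /asboolP[w wx <-] kmin.
by exists w => // z zx; apply: kmin; apply/asboolP; exists z; rewrite // zx.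
Qed.

Lemma reduced_behead s w : reduced (s :: w) -> reduced w.
Proof. by move=> red z zw; have := red (s :: z); rewrite /= zw => /(_ erefl). Qed.

(** A repeated reflection would allow the deletion of two letters: multiplying by
    it twice changes nothing. *)
Lemma uniq_reflections w : reduced w -> uniq (reflections w).
Proof.
elim: w => //= s w IHw red; rewrite (IHw (reduced_behead red)) andbT.
apply/negP => /reflections_delete[z zw sz].
have := red z; rewrite zw !mulgA mulgV mul1g => /(_ erefl).
by rewrite /= -sz => /ltnW; rewrite ltnn.
Qed.

End CoxeterWords.

(** * The geometric representation *)

Section GeometricRepresentation.
Import GRing.Theory Num.Theory.
Variables (V : Type) (m : V -> V -> label).

(** The algebraic analogue of exp(i pi / q), a primitive 2q-th root of unity; for
    an infinite label any number that is not a root of unity does. *)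
Definition half_angle (q : label) : algC :=
  if q is Some q'.+1 then sval (C_prim_root_exists (isT : (0 < q'.+1.*2)%N))
  else 2%R.

Lemma half_angle_expr (q : label) k : q <> Some 0 ->
  (half_angle q ^+ k.*2 == 1)%R = (odflt 0 q %| k).
Proof.
case: q => [[|q]|] //= _.
  case: C_prim_root_exists => z /= zP.
  by rewrite -(prim_order_dvd zP) -!muln2 dvdn_pmul2r.
rewrite dvd0n -natrX (eqr_nat _ _ 1) -(inj_eq double_inj k 0) -(expn0 2).
by rewrite eqn_exp2l.
Qed.

Lemma half_angle_neq0 q : (half_angle q != 0)%R.
Proof.
case: q => [[|q]|] /=; rewrite ?pnatr_eq0 //.
case: C_prim_root_exists => z /= zP; apply/eqP => z0.
by have := prim_expr_order zP; rewrite z0 expr0n /= => /eqP; rewrite eq_sym oner_eq0.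
Qed.

Hypothesis m_graph : coxeter_graph m.
Local Open Scope ring_scope.
Notation gen := (coxeter_gen m).

(** Twice the usual bilinear form: for a finite label off the diagonal this is, up
    to the choice of the root of unity, -2 cos(pi / m s t).  An infinite label
    gives -5/2, for which the product of s and t has the eigenvalues 4 and 1/4 in
    the plane of s and t. *)
Definition cartan s t : algC :=
  if `[< s = t >] then 2 else - (half_angle (m s t) + (half_angle (m s t))^-1).

Lemma cartan_diag s : cartan s s = 2.
Proof. by rewrite /cartan; case: asboolP. Qed.

Lemma cartan_sym s t : cartan s t = cartan t s.
Proof.
rewrite /cartan; case: asboolP => [->|st]; case: asboolP => // [ts|_].
  by case: st.
by rewrite m_graph.1.
Qed.

Lemma cartanE s t : s <> t ->
  cartan s t = - (half_angle (m s t) + (half_angle (m s t))^-1).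
Proof. by rewrite /cartan; case: asboolP. Qed.

(** The contragredient of the usual reflection: acting on all functions on V
    avoids finitely supported ones and bases. *)
Definition simple_reflection s (f : V -> algC) : V -> algC :=
  fun v => f v - f s * cartan s v.

Lemma simple_reflectionK s : involutive (simple_reflection s).
Proof.
move=> f; apply/funext => v; rewrite /simple_reflection cartan_diag; ring.
Qed.

Section RankTwo.
Variables (s t : V).
Hypothesis st : s <> t.
Let xi := half_angle (m s t).
Notation rot := (simple_reflection s \o simple_reflection t).

(** The values at s and t transform among themselves, by a matrix of determinant 1
    and trace xi ^+ 2 + xi ^- 2; these are its two left eigenvectors. *)
Lemma rot_eigen f e : e = xi \/ e = xi^-1 ->
  rot f s + e * rot f t = e ^+ 2 * (f s + e * f t).
Proof.
have xi0 : xi != 0 := half_angle_neq0 _.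
have st' := cartanE st; rewrite -/xi in st'.
rewrite /= /simple_reflection !cartan_diag (cartan_sym t s) st'.
by case=> ->; field.
Qed.

Lemma iter_rot_eigen k f e : e = xi \/ e = xi^-1 ->
  iter k rot f s + e * iter k rot f t = e ^+ k.*2 * (f s + e * f t).
Proof.
move=> eP; elim: k => [|k IHk]; first by rewrite mul1r.
by rewrite iterS rot_eigen // IHk doubleS !exprS; ring.
Qed.

Lemma iter_rot_span k f : exists x y, forall v,
  iter k rot f v = f v + x * cartan s v + y * cartan t v.
Proof.
elim: k => [|k [x [y IHk]]]; first by exists 0, 0 => v; rewrite /=; ring.
set g := iter k rot f in IHk *.
exists (x - (g s - g t * cartan t s)), (y - g t) => v.
by rewrite iterS -/g /= /simple_reflection IHk; ring.
Qed.

(** After q steps both eigenvectors take their initial values, hence so are the values at s and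
    t.  As the change of f is a combination of the rows of s and t of the Cartan
    matrix, and these have an invertible 2 by 2 block, there is no change at all.
    Both steps use that the square of xi is not 1, i.e. that q > 1. *)
Lemma iter_rot_id q : m s t = Some q -> forall f, iter q rot f = f.
Proof.
move=> mst f.
have q2 : (1 < q)%N by have := m_graph.2 s t st; rewrite mst.
have q0 : m s t <> Some 0 by rewrite mst => -[e]; rewrite e in q2.
have xi0 : xi != 0 := half_angle_neq0 _.
have xiq : xi ^+ q.*2 = 1.
  by apply/eqP; rewrite half_angle_expr // mst /= dvdnn.
have xi2 : xi ^+ 2 - 1 != 0.
  rewrite subr_eq0 -[2%N]/(1.*2) half_angle_expr // mst /= dvdn1.
  by move: q2; rewrite ltn_neqAle eq_sym => /andP[].
have e1 := iter_rot_eigen q f (or_introl erefl).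
have e2 := iter_rot_eigen q f (or_intror erefl).
rewrite exprVn xiq invr1 mul1r in e2; rewrite xiq mul1r in e1.
have [x [y gE]] := iter_rot_span q f.
move: (iter q rot f) gE e1 e2 => g gE e1 e2.
have gt : g t = f t.
  apply: (mulfI xi2); apply: (mulfI (invr_neq0 xi0)).
  have -> : xi^-1 * ((xi ^+ 2 - 1) * g t) = (g s + xi * g t) - (g s + xi^-1 * g t).
    by field.
  by rewrite e1 e2; field.
have gs : g s = f s by apply: (addIr (xi * f t)); rewrite -e1 gt.
have es := gE s; have et := gE t.
rewrite cartan_diag (cartan_sym t s) cartanE // -/xi gs in es.
rewrite cartan_diag cartanE // -/xi gt in et.
(* The determinant of the 2 by 2 block is -(xi - xi^-1)^2; solving for x clears
   it against xi ^+ 2. *)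
have x0 : x = 0.
  apply: (mulfI xi2); apply: (mulfI xi2); rewrite mulr0 mulr0.
  have -> : (xi ^+ 2 - 1) * ((xi ^+ 2 - 1) * x) =
    xi ^+ 2 * (2 * (f s - (f s + x * 2 + y * - (xi + xi^-1)))
      + (xi + xi^-1) * (f t - (f t + x * - (xi + xi^-1) + y * 2))) by field.
  by rewrite -es -et !subrr !mulr0 addr0 mulr0.
have y0 : y = 0.
  apply: (mulfI (x := 2)); first by rewrite pnatr_eq0.
  by apply: (addrI (f t)); rewrite mulr0 addr0 [RHS]et x0; ring.
by apply/funext => v; rewrite gE x0 y0; ring.
Qed.

End RankTwo.

Lemma geometric_lift w z : word_val m w = word_val m z ->
  forall f, foldr simple_reflection f w = foldr simple_reflection f z.
Proof.
by apply: coxeter_lift => // [|s t q st mst f];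
  [exact: simple_reflectionK | exact: iter_rot_id].
Qed.

Local Open Scope group_scope.

(** Evaluating the eigenvector on the indicator function of s shows that
    (st)^k = 1 forces the k-th power of the eigenvalue to be 1. *)
Lemma order_coxeter_gen s t : s <> t -> order (gen s * gen t) = m s t.
Proof.
move=> st; have m0 : m s t <> Some 0 by move=> e; have := m_graph.2 s t st; rewrite e.
apply: orderE => // k; split=> [stk|]; last first.
  case mst: (m s t) => [q|] /=; last by rewrite dvd0n => /eqP ->.
  by case/dvdnP=> l ->; rewrite mulnC expgnA (coxeter_relation st mst) expg1n.
rewrite -half_angle_expr //.
pose f := (fun v => if `[< v = s >] then 1 else 0)%R : V -> algC.
have wE : foldr simple_reflection f (flatten (nseq k [:: s; t])) =
          iter k (simple_reflection s \o simple_reflection t) f.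
  by elim: k {stk} => //= k ->.
have := iter_rot_eigen st k f (or_introl erefl); rewrite -wE.
rewrite (@geometric_lift _ [::]) /=; last first.
  rewrite -[RHS]stk; elim: k {stk wE} => //= k ->.
  by rewrite expgS mulgA.
rewrite /f; case: asboolP => // _; case: asboolP => [ts|_]; first by case: st.
by rewrite mulr0 addr0 mulr1 => <-.
Qed.

(** The indicator function of s is fixed by every other simple reflection, but not
    by that of s. *)
Lemma coxeter_gen_notin s : ~ generated [set gen t | t in [set~ s]] (gen s).
Proof.
pose f := (fun v => if `[< v = s >] then 1 else 0)%R : V -> algC.
pose H := [set x | forall w, word_val m w = x -> foldr simple_reflection f w = f].
have fix_word w x : word_val m w = x -> foldr simple_reflection f w = f -> H x.
  by move=> wx wf z zx; rewrite -[RHS]wf; apply: geometric_lift; rewrite zx.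
have sub : is_subgroup H.
  have wordE x : exists w, word_val m w = x.
    by exists (map fst (pres_word x)); rewrite word_val_pres_word.
  split=> [|x y Hx Hy|x Hx]; first exact: (fix_word [::]).
    have [w wx] := wordE x; have [z zy] := wordE y.
    apply: (fix_word (w ++ z)); first by rewrite word_val_cat wx zy.
    by rewrite foldr_cat Hy // Hx.
  have [w wx] := wordE x; have [z zy] := wordE x^-1.
  apply: (fix_word _ _ zy); rewrite -{1}(Hx w wx) -foldr_cat.
  by rewrite (@geometric_lift _ [::]) // word_val_cat wx zy mulVg.
have genH : [set gen t | t in [set~ s]] `<=` H.
  move=> _ [t ts <-]; apply: (fix_word [:: t]); first exact: mulg1.
  apply/funext => v /=; rewrite /simple_reflection {2}/f; case: asboolP => // _.
  by rewrite GRing.mul0r GRing.subr0.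
move/(generated_sub sub genH)/(_ [:: s]); rewrite /= mulg1.
move=> /(_ erefl)/(congr1 (fun g => g s)).
rewrite /simple_reflection /f cartan_diag; case: asboolP => // _ /eqP.
by rewrite GRing.mul1r -GRing.subr_eq0 GRing.addrAC subrr GRing.sub0r oppr_eq0 pnatr_eq0.
Qed.

Lemma coxeter_gen_neq1 s : gen s <> 1.
Proof.
move=> s1; apply: (@coxeter_gen_notin s); rewrite s1.
by case: (generated_subgroup [set gen t | t in [set~ s]]).
Qed.

End GeometricRepresentation.

(** * Intersections of standard parabolic subgroups *)

Section ParabolicIntersection.
Variables (V : Type) (m : V -> V -> label).
Notation W := (coxeter_group m).
Notation gen := (coxeter_gen m).
Notation standard K := (generated [set gen t | t in (K : set V)]).

Lemma word_val_rev w : word_val m (rev w) = (word_val m w)^-1.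
Proof.
elim: w => [|s w IHw]; first by rewrite invg1.
by rewrite rev_cons -cats1 word_val_cat IHw /= mulg1 invgM coxeter_genV.
Qed.

Lemma standard_word (K : set V) x : standard K x ->
  exists z : seq (sig K), word_val m (map sval z) = x.
Proof.
apply: (generated_sub (H := [set x | exists z : seq (sig K), word_val m (map sval z) = x])).
  split=> [|_ _ [w <-] [z <-]|_ [w <-]]; first by exists [::].
    by exists (w ++ z); rewrite map_cat word_val_cat.
  by exists (rev w); rewrite map_rev word_val_rev.
by move=> _ [t Kt <-]; exists [:: exist K t Kt]; exact: mulg1.
Qed.

Lemma standard_reflections (K : set V) (z : seq (sig K)) x :
  x \in reflections m (map sval z) -> standard K x.
Proof.
have [g1 gM gV] := generated_subgroup [set gen t | t in K].
have gK t : K t -> standard K (gen t) by move=> Kt; apply: sub_generated; exists t.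
have gz (w : seq (sig K)) : standard K (word_val m (map sval w)).
  by elim: w => [|[t Kt] w IHw] //=; apply: gM => //; exact: gK.
elim: z => [|[t Kt] w IHw] //=; rewrite inE => /orP[/eqP ->|//].
by apply: (gM) => //; apply: gM; [exact: gV | exact: gK].
Qed.

(** A reflection along a reduced word occurs there exactly once, so it occurs an odd
    number of times, hence at least once, along a word with letters in K. *)
Lemma reduced_reflections (K : set V) w x : reduced m w ->
  standard K (word_val m w) -> x \in reflections m w -> standard K x.
Proof.
move=> red /standard_word[z zw] xw; apply: (@standard_reflections K z).
rewrite -has_pred1 has_count odd_gt0 // (reflections_parity zw).
by rewrite count_uniq_mem ?uniq_reflections // xw.
Qed.

Hypothesis m_graph : coxeter_graph m.

(** If all reflections along a word of x lie in W_s for every s in J, then so do its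
    letters, from last to first: a letter is a conjugate of its reflection by the
    value of the rest of the word. *)
Lemma coxeter_parabolic (J : set V) :
  parabolic (S := coxeter_system m) J = standard (~` J).
Proof.
apply/seteqP; split=> [x Jx|]; last first.
  apply: generated_sub.
    split=> [s Js|x y Hx Hy s Js|x Hx s Js];
      have [g1 gM gV] := generated_subgroup [set gen t | t in [set~ s]].
    - exact: g1.
    - by apply: gM; [exact: Hx | exact: Hy].
    - by apply: gV; exact: Hx.
  move=> _ [t Jt <-] s Js; apply: sub_generated; exists t => // ts.
  by apply: Jt; rewrite ts.
have [w wx red] := reduced_word x; rewrite -wx.
have : forall r, r \in reflections m w -> forall s, J s -> standard [set~ s] r.
  move=> r rw s Js; apply: (reduced_reflections red) => //; rewrite wx.
  exact: Jx.
have [g1 gM gV] := generated_subgroup [set gen t | t in ~` J].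
elim: w {wx red x Jx} => [|s w IHw] //= refl.
have Hw : standard (~` J) (word_val m w).
  by apply: IHw => r rw; apply: refl; rewrite inE rw orbT.
apply: gM => //; apply: sub_generated; exists s => // Js.
apply: (coxeter_gen_notin m_graph (s := s)).
have sub : standard (~` J) `<=` standard [set~ s].
  apply: generated_sub; first exact: generated_subgroup.
  by move=> _ [t Jt <-]; apply: sub_generated; exists t => // ts; apply: Jt; rewrite ts.
have [h1 hM hV] := generated_subgroup [set gen t | t in [set~ s]].
(* Otherwise s, the conjugate of the first reflection by the tail of the word,
   would be in its own maximal parabolic. *)
have -> : gen s =
    word_val m w * ((word_val m w)^-1 * gen s * word_val m w) * (word_val m w)^-1.
  by rewrite !mulgA mulgV mul1g mulgK.
apply: (hM); last by apply: hV; exact: sub.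
by apply: hM; [exact: sub | apply: refl; rewrite ?inE ?eqxx].
Qed.

Lemma coxeter_core x : parabolic (S := coxeter_system m) [set: V] x -> x = 1.
Proof.
rewrite coxeter_parabolic // setCT image_set0 => H.
apply: (H [set 1]); split=> //; split=> // [y z -> ->|y ->].
  exact: mulg1.
exact: invg1.
Qed.

End ParabolicIntersection.

(** * Distinguished generators of a regular hypertope *)

Section Hypertope.
Variables (I : Type) (beta : cosys I) (b : I -> beta).
Hypothesis beta_hypertope : regular_hypertope beta.
Hypothesis b_generators : distinguished_generators b.

Lemma distinguished_in i l : l <> i -> cs_par beta l (b i).
Proof.
move=> li; have [_ _ pb] := b_generators i.
have : parabolic [set~ i] (b i) by rewrite pb; exact: sub_generated.
by apply.
Qed.

(** The flag of the cosets B_l with l <> i is contained in a chamber other than the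
    base one, and the element of B sending the base chamber there fixes this
    flag without being in B_i.  Being in the subgroup generated by b_i, it is
    b_i. *)
Lemma distinguished_notin i : ~ cs_par beta i (b i).
Proof.
have [subB _ thinB _ [ftB _]] := beta_hypertope.
have [_ bb pb] := b_generators i.
pose std l : I * set beta := (l, cs_par beta l).
pose Phi := std @` [set~ i].
have std_el l : element (std l) by exists 1 => //; rewrite ltrans1.
have std1 l : (std l).2 1 by case: (subB l).
have flagPhi : flag Phi.
  split=> [_ [l _ <-]|_ _ [l _ <-] [l' _ <-]]; first exact: std_el.
  by exists 1; split; exact: std1.
have typesPhi : types_of Phi = [set~ i].
  by apply/seteqP; split=> [_ [_ [l li <-] <-] //|l li];
    exists (std l) => //; exists l.
have [x [y [xy resE]]] := thinB Phi i flagPhi typesPhi.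
(* z completes the flag to the second chamber. *)
have [z zres zi] : exists2 z, residue Phi z & z <> std i.
  have [xi|xi] := pselect (x = std i); [exists y|exists x]; rewrite ?resE //=.
  - by right.
  - by rewrite -xi => yx; apply: xy.
  - by left.
have [zel zPhi zinc] := zres.
have z1 : z.1 = i.
  apply: contrapT => z1; apply: (zPhi); exists z.1 => //.
  have -> : z = (z.1, z.2) by case: (z).
  congr pair; apply/esym; apply: (coset_meet (subB z.1)) => //.
  by apply: (zinc (std z.1)); exists z.1.
have flag1 u : element u -> (forall v, Phi v -> incident u v) -> flag (Phi `|` [set u]).
  move=> uel uinc; split=> [v [/flagPhi.1 //|-> //]|v w [Pv|->] [Pw|->]].
  - exact: flagPhi.2.
  - by rewrite /incident setIC; exact: uinc.
  - exact: uinc.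
  case: uel => c _ ce; exists c; rewrite -ce; split; exact: ltrans_refl.
have flagi : flag (Phi `|` [set std i]).
  apply: flag1 => // _ [l _ <-]; exists 1; split; exact: std1.
have flagz := flag1 z zel zinc.
have [|c cE] := ftB _ _ flagi flagz.
  by rewrite /types_of !image_setU !image_set1 z1.
have cmem l : (Phi `|` [set z]) (translate c (std l)).
  rewrite -cE; exists (std l) => //.
  by have [->|li] := pselect (l = i); [right|left; exists l].
have cin l : l <> i -> cs_par beta l c.
  move=> li; have [[l' _ [ll' e]]|zl] := cmem l.
    by apply: (ltrans_eq (subB l)); rewrite -e ll'.
  by case: li; rewrite -z1 -zl.
have ci : ~ cs_par beta i c.
  move=> ci; have : translate c (std i) = std i.
    by rewrite /translate /= (ltrans_id (subB i)).
  have [[l li [e _]]|->//] := cmem i.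
  by case: li.
have : parabolic [set~ i] c by move=> l li; exact: cin.
rewrite pb generated_involution // => -[c1|cb]; last by rewrite -cb.
by case: ci; rewrite c1; case: (subB i).
Qed.

Lemma parabolic_setT_trivial (i : I) c : (forall l, cs_par beta l c) -> c = 1.
Proof.
move=> cB; have [_ bb pb] := b_generators i.
have : parabolic [set~ i] c by move=> l _.
rewrite pb generated_involution // => -[//|cb].
by case: (@distinguished_notin i); rewrite -cb.
Qed.

End Hypertope.

(** * The twisting of a Coxeter system *)

Section SemidirectFacts.
Variables (B A : groupType) (eta : aut_action B A).

Lemma sd_mulE x y c d :
  SemiDirect eta x c * SemiDirect eta y d = SemiDirect eta (x * eta c y) (c * d).
Proof. by []. Qed.

Lemma order_sd_right c : order (SemiDirect eta 1 c) = order c.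
Proof.
apply: eq_order_expg => k.
have -> : SemiDirect eta 1 c ^+ k = SemiDirect eta 1 (c ^+ k).
  by elim: k => // k IHk; rewrite !expgS IHk sd_mulE aut_act1 mulg1.
by split=> [[]|->].
Qed.

Lemma order_sd_left x : order (SemiDirect eta x 1) = order x.
Proof.
apply: eq_order_expg => k.
have -> : SemiDirect eta x 1 ^+ k = SemiDirect eta (x ^+ k) 1.
  by elim: k => // k IHk; rewrite !expgS IHk sd_mulE act_1 mulg1.
by split=> [[]|->].
Qed.

(** Odd powers of (x, c) have second component c, and the square of (x, c) is
    (x (c x), 1). *)
Lemma order_sd_involution x c : c <> 1 -> c * c = 1 ->
  order (SemiDirect eta x c) = label_double (order (x * eta c x)).
Proof.
move=> c1 cc; rewrite order_double.
  by rewrite sd_mulE cc order_sd_left.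
move=> k yk; have : sd_right (SemiDirect eta x c ^+ k) = c ^+ k.
  by elim: k {yk} => // k IHk; rewrite !expgS -IHk.
rewrite yk /= => ck; have /eqP := esym ck.
have := (expg_order c k).1 (esym ck).
by rewrite (order_involution c1 cc) /= dvdn2.
Qed.

End SemidirectFacts.

Section TwistCoxeter.
Variables (I V : Type) (m : V -> V -> label) (beta : cosys I) (b : I -> beta).
Variables (a : action beta V) (F : orbits a -> V).
Hypothesis a_inv : forall c s t, m (a c s) (a c t) = m s t.
Hypothesis m_graph : coxeter_graph m.
Hypothesis beta_hypertope : regular_hypertope beta.
Hypothesis b_generators : distinguished_generators b.
Hypothesis F_orbit : forall L : orbits a, val L (F L).
Variable i0 : I.
Hypothesis F_separated : forall (L : orbits a) v, val L v ->
  (forall i, [set a c (F L) | c in cs_par beta i] v) -> v = F L.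

Notation gen := (coxeter_gen m).
Let alpha : cosys V := coxeter_system m.
Let eta : aut_action beta alpha := coxeter_aut a_inv.

Definition twist_gen (x : I + orbits a) : twist eta F :=
  match x with
  | inl i => SemiDirect eta 1 (b i)
  | inr L => SemiDirect eta (gen (F L) : alpha) 1
  end.

(** In the intersection of all maximal parabolics but one, the first component ranges
    over the intersection of the maximal parabolics of A over all vertices v,
    when the omitted type is in I, and over all v but F L, when it is L; the second
    component ranges over the subgroup generated by b i, respectively the trivial
    group. *)
Lemma twist_gen_generators : distinguished_generators twist_gen.
Proof.
have [subB _ _ _ _] := beta_hypertope.
have par1 J : parabolic (S := alpha) J 1.
  by move=> s _; case: (generated_subgroup [set gen t | t in [set~ s]]).
case=> [i|L].
  have [bi1 bb pb] := b_generators i.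
  have gg : twist_gen (inl i) * twist_gen (inl i) = 1.
    by rewrite [LHS]sd_mulE aut_act1 mulg1 bb.
  split=> //; first by case=> bi; apply: bi1.
  rewrite generated_involution //; apply/seteqP; split=> [[x c] xc|].
    have x1 : x = 1.
      apply: (coxeter_core m_graph) => s _.
      have [+ _] := xc (inr (orbit_of a s)) (fun e => ltac:(discriminate e)).
      by apply; exact: orbit_refl.
    have : parabolic [set~ i] c by move=> l li; have [] := xc (inl l) (fun e => li (inl_inj e)).
    by rewrite pb generated_involution // x1 => -[->|->]; [left|right].
  move=> _ [->|->] [l|L] lx; split=> //=; try exact: par1.
    by case: (subB l).
  by apply: distinguished_in => // li; apply: lx; rewrite li.
have gg : twist_gen (inr L) * twist_gen (inr L) = 1.
  by rewrite [LHS]sd_mulE act_1 coxeter_gen_sq mulg1.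
split=> //; first by case; exact: (coxeter_gen_neq1 m_graph).
rewrite generated_involution //; apply/seteqP; split=> [[x c] xc|].
  have xci i := xc (inl i) (fun e => ltac:(discriminate e)).
  have c1 : c = 1.
    by apply: (parabolic_setT_trivial beta_hypertope b_generators i0) => i; case: (xci i).
  have : parabolic (S := alpha) [set~ F L] x.
    move=> s sF; have [sL|sL] := pselect (orbit_of a s = L); last first.
      have [+ _] := xc (inr (orbit_of a s)) (fun e => sL (inr_inj e)).
      by apply; exact: orbit_refl.
    have Ls : val L s by rewrite -sL; exact: orbit_refl.
    have [i si] : exists i, ~ [set a c (F L) | c in cs_par beta i] s.
      by apply/existsNP => all; apply: sF; exact: F_separated.
    by have [+ _] := xci i; apply; exists L.
  rewrite coxeter_parabolic // setCK image_set1 generated_involution; last first.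
    exact: coxeter_gen_sq.
  by rewrite c1 => -[->|->]; [left|right].
have parF s : s <> F L -> cs_par alpha s (gen (F L)).
  by move=> sF; apply: sub_generated; exists (F L) => // e; apply: sF.
move=> _ [->|->] [l|L'] lx; split=> //=; try exact: par1; try by case: (subB l).
  move=> s [L' _ [Ls si]]; apply: parF => sF; apply: si.
  rewrite (orbits_eq Ls) sF -(orbits_eq (F_orbit L)).
  by exists 1; [case: (subB l)|rewrite act_1].
move=> s Ls; apply: parF => sF; apply: lx.
by rewrite (orbits_eq Ls) sF -(orbits_eq (F_orbit L)).
Qed.

Lemma twist_diagram_inl_inl i l : diagram twist_gen (inl i) (inl l) = diagram b i l.
Proof.
by rewrite /diagram [X in order X]sd_mulE aut_act1 mulg1 order_sd_right.
Qed.

Lemma twist_diagram_inr_inr L L' : L <> L' ->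
  diagram twist_gen (inr L) (inr L') = m (F L) (F L').
Proof.
move=> LL; rewrite -(order_coxeter_gen m_graph); last first.
  by move=> e; apply: LL; rewrite (orbits_eq (F_orbit L)) e -(orbits_eq (F_orbit L')).
by rewrite /diagram [X in order X]sd_mulE act_1 mulg1 order_sd_left.
Qed.

Lemma twist_diagram_inl_inr i L : diagram twist_gen (inl i) (inr L) =
  if `[< a (b i) (F L) = F L >] then Some 2
  else label_double (m (F L) (a (b i) (F L))).
Proof.
have [bi1 bb _] := b_generators i.
have actE c s : eta c (gen s) = gen (a c s) by exact: coxeter_act_gen.
rewrite /diagram [X in order X]sd_mulE mul1g mulg1 actE.
rewrite order_sd_involution // actE -act_M bb act_1.
case: asboolP => [->|FL].
  by rewrite coxeter_gen_sq (@orderE _ 1 (Some 1%N)) // => k; rewrite expg1n dvd1n.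
by rewrite order_coxeter_gen // m_graph.1.
Qed.

Lemma twist_diagram_inr_inl i L :
  diagram twist_gen (inr L) (inl i) = diagram twist_gen (inl i) (inr L).
Proof. exact: order_mulC. Qed.

End TwistCoxeter.

(** * The extension along a diagonal Coxeter graph *)

Section Extension.
Variables (IG I : Type) (mG : IG -> IG -> label) (k : IG).
Variables (beta : cosys I) (j : I) (lam : set (set (set beta)) -> label).
Hypothesis subB : is_subgroup (cs_par beta j).
Hypothesis mG_graph : coxeter_graph mG.
Hypothesis lam_ge2 :
  forall c, diagonal_classes (cs_par beta j) c -> label_ge2 (lam c).
Notation vertex := (K_vertex k beta j).
Notation base := (K_base k beta j).
Notation incl := (K_incl k beta j).
Notation act := (K_action k beta j).
Notation graph := (K_graph mG (k := k) (j := j) lam).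

(** A left inverse of the inclusion of the vertices of G: it collapses the whole
    orbit X_j to k. *)
Definition vertex_name (v : vertex) : IG := if v is inl u then val u else k.

Lemma K_incl_val (u : [set~ k]) : incl (val u) = inl u.
Proof. by rewrite /K_incl /ext_incl valK. Qed.

Lemma K_incl_base : incl k = base.
Proof.
rewrite /K_incl /ext_incl; case: insubP => // u /set_mem /= uk e.
by case: uk.
Qed.

Lemma vertex_incl w : w = k \/ exists u : [set~ k], w = val u.
Proof.
have [->|wk] := pselect (w = k); [by left | right].
by exists (exist _ w (mem_set (wk : [set~ k] w))).
Qed.

Lemma K_inclK : cancel incl vertex_name.
Proof.
by move=> w; have [->|[u ->]] := vertex_incl w; rewrite ?K_incl_base ?K_incl_val.
Qed.

Lemma diagonal_graph_sym F1 F2 :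
  diagonal_graph (H := cs_par beta j) lam F1 F2 = diagonal_graph lam F2 F1.
Proof.
rewrite /diagonal_graph; congr lam.
by apply/seteqP; split=> _ [c _ <-]; exists c; rewrite // setUC.
Qed.

Lemma K_graph_coxeter : coxeter_graph graph.
Proof.
have [mG_sym mG_ge2] := mG_graph.
split=> [[u|F1] [v|F2]|[u|F1] [v|F2] uv] //=; try exact: mG_sym.
- exact: diagonal_graph_sym.
- by apply: mG_ge2 => /val_inj e; apply: uv; rewrite e.
- by apply: mG_ge2; exact: (set_mem (valP u)).
- by apply: mG_ge2; exact: (set_mem (valP v)).
by apply: lam_ge2; exists F1, F2; split=> // e; apply: uv; rewrite e.
Qed.

Lemma K_graph_incl w w' : w <> w' -> graph (incl w) (incl w') = mG w w'.
Proof.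
have [mG_sym _] := mG_graph.
have [->|[u ->]] := vertex_incl w; have [->|[v ->]] := vertex_incl w' => //;
  by rewrite ?K_incl_base ?K_incl_val //= mG_sym.
Qed.

Lemma K_action_incl c w : w <> k -> act c (incl w) = incl w.
Proof. by have [->|[u ->]] := vertex_incl w; rewrite // K_incl_val. Qed.

Lemma K_action_base c : act c base = base <-> cs_par beta j c.
Proof.
split=> [[]|cB].
  by rewrite -ltransM mulg1 ltrans1; exact: ltrans_eq.
by congr inr; apply: val_inj; rewrite /= -ltransM mulg1 ltrans1; exact: ltrans_id.
Qed.

Lemma K_orbit_incl (L : orbits act) : exists w, L = orbit_of act (incl w).
Proof.
case: L => L LP; have [v _ vL] := set_mem LP.
suff [w wL] : exists w, L (incl w).
  by exists w; exact: (@orbits_eq _ _ act (exist _ L LP)).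
rewrite -vL; case: v {vL} => [u|[E EP]].
  by exists (val u); rewrite K_incl_val; exact: orbit_refl.
have [x _ xE] := set_mem EP.
exists k; exists x^-1 => //; rewrite K_incl_base; congr inr; apply: val_inj => /=.
by rewrite -xE -ltransM mulVg.
Qed.

Section Representatives.
Variable F : orbits act -> vertex.
Hypothesis F_orbit : forall L, val L (F L).
Hypothesis F_base : F (orbit_of act base) = base.

Lemma representative_incl w : F (orbit_of act (incl w)) = incl w.
Proof.
have [->|wk] := pselect (w = k); first by rewrite K_incl_base.
by have [c _ <-] := F_orbit (orbit_of act (incl w)); exact: K_action_incl.
Qed.

(** Taking only the type j suffices to separate the representatives: B_j fixes each
    of them. *)
Lemma representative_fixed (L : orbits act) v :
  [set act c (F L) | c in cs_par beta j] v -> v = F L.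
Proof.
have [w ->] := K_orbit_incl L; rewrite representative_incl => -[c cB <-].
have [->|wk] := pselect (w = k); last exact: K_action_incl.
by rewrite K_incl_base; exact/K_action_base.
Qed.

Lemma twist_type_bijective : bijective (twist_type k beta j).
Proof.
rewrite -setTT_bijective; split=> // [|[i|L] _]; last 2 first.
- by exists (inl i).
- by have [w ->] := K_orbit_incl L; exists (inr w).
move=> [i|w] [l|w'] _ _ //= [e]; first by rewrite e.
have ww : orbit_of act (incl w) = orbit_of act (incl w') by exact: val_inj.
by congr inr; apply: (can_inj K_inclK); rewrite -representative_incl ww representative_incl.
Qed.

End Representatives.
End Extension.

Theorem corollary3p15 (n : nat) (beta : cosys 'I_n) (b : 'I_n -> beta)
  (j : 'I_n) (lam : set (set (set beta)) -> label)
  (r : nat) (mG : 'I_r -> 'I_r -> label) (k : 'I_r)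
  (hbeta : regular_hypertope beta)
  (hb : distinguished_generators b)
  (hfin : finite_set (cosets (cs_par beta j)))
  (hmany : exists F1 F2 : cosets (cs_par beta j), F1 <> F2)
  (hlam : forall c, diagonal_classes (cs_par beta j) c -> label_ge2 (lam c))
  (hG : coxeter_graph mG)
  (F : orbits (K_action k beta j) -> K_vertex k beta j)
  (hF : forall L : orbits (K_action k beta j), val L (F L))
  (hFD : F (orbit_of (K_action k beta j) (K_base k beta j)) = K_base k beta j) :
  exists g : 'I_n + orbits (K_action k beta j) -> twist (K_aut mG k j lam) F,
    distinguished_generators g /\
    graph_isomorphism
      (join_graph (diagram b) mG j k
         (label_double (lam (diagonal_class (cs_par beta j) (ltrans (b j) (cs_par beta j))))))
      (diagram g)
      (twist_type k beta j).
Proof.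
have [subB _ _ _ _] := hbeta.
have K_cox := K_graph_coxeter k hG hlam.
pose g := twist_gen b F (@K_action_graph _ _ mG k beta j lam).
have fixed := representative_fixed (subB j) hF hFD.
have Fincl := representative_incl hF hFD.
exists g; split.
  apply: (twist_gen_generators _ K_cox hbeta hb hF j) => L v _ all.
  exact/fixed/all.
have lr i w : diagram g (inl i) (twist_type k beta j (inr w)) =
    if (i == j) && (w == k) then
      label_double (lam (diagonal_class (cs_par beta j) (ltrans (b j) (cs_par beta j))))
    else Some 2.
  rewrite /g (twist_diagram_inl_inr F _ K_cox hb) Fincl.
  case: (eqVneq w k) => [->|/eqP wk]; last first.
    by rewrite andbF K_action_incl //; case: asboolP.
  rewrite K_incl_base andbT (propext (K_action_base _ (subB j) _)).
  case: eqVneq => [->|/eqP ij]; last first.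
    case: asboolP => // bi; case: bi; apply: distinguished_in => //.
    by move=> ji; apply: ij.
  case: asboolP => [/(distinguished_notin hbeta hb)//|_].
  by rewrite /= /diagonal_graph /= -ltransM mulg1 ltrans1.
split; first exact: twist_type_bijective hF hFD.
move=> [i|w] [l|w'] st.
- exact: twist_diagram_inl_inl.
- exact: lr.
- by transitivity (diagram g (inl l) (twist_type k beta j (inr w)));
    [exact: twist_diagram_inr_inl | exact: lr].
have ww : w <> w' by move=> e; apply: st; rewrite e.
rewrite /g /= (twist_diagram_inr_inr b _ K_cox hF) ?Fincl ?K_graph_incl //.
by move/(congr1 F); rewrite !Fincl => /(can_inj (@K_inclK _ _ k beta j)).
Qed.
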